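(* Let $n \ge d \ge 2$ and let $M$ be a matching of $Q_n$ that spans at most $d$ directions. Suppose the following property holds in dimension $d$: for every matching $M'$ of $Q_d$ and every two vertices $u,v\in V(Q_d)$ of opposite parity such that $u$ is not covered by $M'$, there is a Hamilton path of $Q_d$ between $u$ and $v$ containing all edges of $M'$. Then $M$ can be extended to a Hamilton cycle of $Q_n$ (a Hamilton cycle containing all edges of $M$).
   Context: $Q_n$ is the hypercube with vertex set $\{0,1\}^n$, adjacency meaning difference in exactly one coordinate. The parity of a vertex is the parity of its number of ones. The direction of an edge $uv$ is the coordinate in which $u,v$ differ; a matching spans at most $d$ directions if its edges lie in at most $d$ distinct directions. A vertex is covered by a matching if it is an endpoint of one of its edges. *)

(* Defs.v *)
From mathcomp Require Import all_boot.

Set Implicit Arguments.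
Unset Strict Implicit.
Unset Printing Implicit Defensive.

(* A simple graph on a finite type T is a symmetric irreflexive relation on T;
   its edges are the two-element sets of adjacent vertices. *)
Section Graph.
Variables (T : finType) (e : rel T).

Definition edge_set : {set {set T}} :=
  [set [set p.1; p.2] | p in [pred p : T * T | e p.1 p.2]].

Definition matching (M : {set {set T}}) : bool :=
  (M \subset edge_set) && trivIset M.

Definition covered (M : {set {set T}}) (u : T) : bool := u \in cover M.

Definition walk_edges (x : T) (s : seq T) : seq {set T} :=
  pairmap (fun a b => [set a; b]) x s.

(* The path has vertex sequence u :: s. *)
Definition hamilton_path (u v : T) (s : seq T) : Prop :=
  [/\ path e u s, last u s = v, uniq (u :: s) & u :: s =i predT].

Definition path_contains (M : {set {set T}}) (u : T) (s : seq T) : Prop :=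
  {subset M <= walk_edges u s}.

(* The vertices of the cycle are listed once each; the last one is adjacent to
   the first. *)
Definition hamilton_cycle (c : seq T) : Prop :=
  [/\ cycle e c, uniq c, 2 < size c & c =i predT].

Definition cycle_edges (c : seq T) : seq {set T} :=
  if c is x :: s then walk_edges x (rcons s x) else [::].

Definition cycle_contains (M : {set {set T}}) (c : seq T) : Prop :=
  {subset M <= cycle_edges c}.

End Graph.

Definition vertex (n : nat) : finType := {ffun 'I_n -> bool}.

Definition Q (n : nat) : rel (vertex n) :=
  fun u v => #|[set i | u i != v i]| == 1.

Definition parity (n : nat) (u : vertex n) : bool := odd #|[set i | u i]|.

Definition directions (n : nat) (M : {set {set vertex n}}) : {set 'I_n} :=
  [set i | [exists u : vertex n, exists v : vertex n,
             ([set u; v] \in M) && (u i != v i)]].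

Lemma Q_sym n : symmetric (@Q n).
Proof.
by move=> u v; rewrite /Q; congr (#|pred_of_set _| == 1); apply/setP=> i; rewrite !inE eq_sym.
Qed.

Lemma Q_irr n : irreflexive (@Q n).
Proof.
move=> u; rewrite /Q; suff -> : [set i | u i != u i] = set0 by rewrite cards0.
by apply/setP=> i; rewrite !inE eqxx.
Qed.

(* Main.v *)
Require Import Defs.
From mathcomp Require Import all_boot.

(** If [M] is perfect, the result is Fink's theorem (Kreweras' conjecture),
    proved by induction on subcubes for perfect matchings [P] of the complete
    graph on the vertices: split along a direction crossed by [P], complete the
    part of [P] inside one half arbitrarily, apply induction there, replace the
    resulting paths by single edges in the other half, and apply induction again.
    Matchings are fixed-point-free involutions, and since the union of two
    perfect matchings is 2-regular, being a Hamilton cycle becomes connectedness.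

    If [M] misses a vertex [z], let [D] be a set of [d] directions containing
    those of [M], and visit the copies of [Q_d] spanned by [D] along a cyclic
    Gray code that ends in the copy of [z].  The hypothesis lets one traverse
    each copy through its part of [M] from any prescribed entry vertex, and in
    the last copy also prescribe the exit vertex [z], because [M] misses [z].
    Starting at a neighbour of [z] in the first copy, the path closes up. *)

Set Implicit Arguments.
Unset Strict Implicit.
Unset Printing Implicit Defensive.

(** * Fixed-point-free involutions and unions of two of them *)

Section Pairing.
Variable T : finType.
Implicit Types (A B : {set T}) (p r s : T -> T) (e : rel T).

Definition fpf_involution A p : Prop :=
  forall x, x \in A -> [/\ p x \in A, p (p x) = x & p x != x].

(** The orbits [{x, p x}] have two elements; each induction step removes one orbit. *)
Lemma fpf_involution_even A p : fpf_involution A p -> ~~ odd #|A|.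
Proof.
have [m] := ubnP #|A|; elim: m => // m IHm in A * => ltAm pA.
have [->|[x xA]] := set_0Vmem A; first by rewrite cards0.
have [pxA ppx pxx] := pA x xA.
have cA : #|A| = #|A :\ x :\ p x|.+2.
  by rewrite (cardsD1 x) xA (cardsD1 (p x) (A :\ x)) !inE pxx pxA.
rewrite cA /= negbK; apply: IHm; first by rewrite -ltnS ltnW // -cA.
move=> y /setD1P[ypx /setD1P[yx yA]]; have [pyA ppy pyy] := pA y yA.
split=> //; rewrite !inE pyA andbT; apply/andP; split; apply/eqP=> eq_py.
  by rewrite -ppy eq_py ppx eqxx in yx.
by rewrite -ppy eq_py eqxx in ypx.
Qed.

(** Two elements of one class are paired and removed together, so each class loses two elements or
    none and stays even. *)
Lemma even_class_pairing A e :
    reflexive e -> symmetric e -> transitive e ->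
    (forall x, x \in A -> ~~ odd #|[set y in A | e x y]|) ->
  exists s, fpf_involution A s /\ forall x, x \in A -> e x (s x).
Proof.
move=> e_refl e_sym e_tr.
have [m] := ubnP #|A|; elim: m => // m IHm in A * => ltAm evA.
have [->|[x xA]] := set_0Vmem A; first by exists id; split=> x; rewrite inE.
have [y /setD1P[yx]] : exists y, y \in [set y in A | e x y] :\ x.
  apply/set0Pn; rewrite -cards_eq0; apply: contraNneq (evA x xA) => c0.
  by rewrite (cardsD1 x) !inE xA e_refl c0.
rewrite inE => /andP[yA exy].
have cB B : x \in B -> y \in B -> #|B| = #|B :\ x :\ y|.+2.
  by move=> xB yB; rewrite (cardsD1 x) xB (cardsD1 y (B :\ x)) !inE yx yB.
have [||s [sA es]] := IHm (A :\ x :\ y); first by rewrite -ltnS ltnW // -cB.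
  move=> z /setD1P[zy /setD1P[zx zA]]; have := evA z zA.
  have -> : [set w in A :\ x :\ y | e z w] = [set w in A | e z w] :\ x :\ y.
    by apply/setP=> w; rewrite !inE -!andbA.
  have [ezx|nezx] := boolP (e z x).
    have ezy : e z y by apply: e_tr ezx exy.
    by rewrite cB ?inE ?xA ?yA ?ezx ?ezy //= negbK.
  have nezy : ~~ e z y.
    by apply: contra nezx => ezy; apply: e_tr ezy _; rewrite e_sym.
  suff -> : [set w in A | e z w] :\ x :\ y = [set w in A | e z w] by [].
  apply/setP=> w; rewrite !inE.
  have [->|_] := eqVneq w y; first by rewrite (negPf nezy) andbF.
  by have [->|_] := eqVneq w x; first by rewrite (negPf nezx) andbF.
exists (fun z => if z == x then y else if z == y then x else s z); split=> z zA.
  have [->|zx] := eqVneq z x; first by rewrite (negPf yx) eqxx.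
  have [->|zy] := eqVneq z y; first by rewrite eqxx; split; rewrite // eq_sym.
  have [|/setD1P[sy /setD1P[sx szA]] ssz szz] := sA z; first by rewrite !inE zy zx.
  by rewrite (negPf sx) (negPf sy).
have [->|zx] := eqVneq z x; first by [].
have [->|zy] := eqVneq z y; first by rewrite e_sym.
by apply: es; rewrite !inE zy zx.
Qed.

Lemma even_pairing A : ~~ odd #|A| -> exists s, fpf_involution A s.
Proof.
move=> evA; have [||||s [sA _]] := @even_class_pairing A (fun _ _ => true) => //.
  by move=> x _; rewrite (_ : [set y in A | true] = A) //; apply/setP=> y; rewrite !inE andbT.
by exists s.
Qed.

(** Induction along a walk from [x] to [y]: membership in [A] is carried forwards from [x], the
    property [P] backwards from [y]. *)
Lemma connect_ind_in A (P : T -> Prop) e y :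
    {in A, forall x x', e x x' -> x' \in A /\ (P x' -> P x)} -> P y ->
  forall x, x \in A -> connect e x y -> P x.
Proof.
move=> step Py x xA /connectP[s]; elim: s => [|x' s IHs] /= in x xA *.
  by move=> _ <-.
by case/andP=> exx' es ys; have [x'A Px'] := step x xA x' exx'; apply/Px'/IHs.
Qed.

(** Both ends are required in [A] because [p] may be a pairing of a larger set; its edges that leave
    [A] are then dropped. *)
Definition union_graph A p r : rel T :=
  [rel x y | [&& x \in A, y \in A & (y == p x) || (y == r x)]].

Lemma union_graphE A p r x y : union_graph A p r x y =
  [&& x \in A, y \in A & (y == p x) || (y == r x)].
Proof. by []. Qed.

Lemma union_graph_sym A p r :
    {in A, forall x, p (p x) = x} -> {in A, forall x, r (r x) = x} ->
  symmetric (union_graph A p r).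
Proof.
move=> pp rr x y; rewrite /union_graph /=.
case xA: (x \in A); case yA: (y \in A) => //=.
have eq_inv f : {in A, forall x, f (f x) = x} -> (y == f x) = (x == f y).
  by move=> ff; apply/eqP/eqP=> ->; rewrite ff.
by rewrite (eq_inv p) ?(eq_inv r).
Qed.

End Pairing.

(** * Flips, parity, subcubes, and Fink's theorem on subcubes *)

Section Cube.
Variable n : nat.
Implicit Types (x y z a b : vertex n) (i j k : 'I_n) (D : {set 'I_n}).

Definition flip x i : vertex n := [ffun k => (k == i) (+) x k].

Lemma flipK i : involutive (flip^~ i).
Proof. by move=> x; apply/ffunP=> k; rewrite !ffunE addKb. Qed.

Lemma flip_at x i : flip x i i = ~~ x i.
Proof. by rewrite ffunE eqxx. Qed.

Lemma flip_neq x i k : k != i -> flip x i k = x k.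
Proof. by move=> /negPf ki; rewrite ffunE ki. Qed.

Lemma QP x y : reflect (exists i, y = flip x i) (Q x y).
Proof.
apply: (iffP cards1P) => [[i /setP xy]|[i ->]]; exists i.
  apply/ffunP=> k; have := xy k; rewrite !inE ffunE => <-.
  by case: (x k) (y k) => [] [].
by apply/setP=> k; rewrite !inE ffunE; case: (k == i) (x k) => [] [].
Qed.

Lemma Q_flip x i : Q x (flip x i).
Proof. by apply/QP; exists i. Qed.

Lemma parity_flip x i : parity (flip x i) = ~~ parity x.
Proof.
have half z : z i -> parity z = ~~ parity (flip z i).
  move=> zi; rewrite /parity (cardsD1 i) inE zi /=; congr (~~ odd #|pred_of_set _|).
  by apply/setP=> k; rewrite !inE ffunE; case: eqP => // ->; rewrite zi.
have [xi|xi] := boolP (x i); first by rewrite (half x) ?negbK.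
by rewrite half ?flip_at // flipK.
Qed.

Lemma Q_parity x y : Q x y -> parity y = ~~ parity x.
Proof. by case/QP=> i ->; rewrite parity_flip. Qed.

(** The subcube through [a] whose free directions are [D]. *)
Definition cube D a : {set vertex n} :=
  [set x : vertex n | [forall i, (i \notin D) ==> (x i == a i)]].

Lemma cubeP D a x :
  reflect (forall i, i \notin D -> x i = a i) (x \in cube D a).
Proof.
rewrite inE; apply: (iffP forallP) => xa i; last by apply/implyP=> /xa->.
by move=> iD; apply/eqP/(implyP (xa i)).
Qed.

Lemma cube_refl D a : a \in cube D a.
Proof. exact/cubeP. Qed.

Lemma cube_sym D a x : (x \in cube D a) = (a \in cube D x).
Proof. by apply/cubeP/cubeP=> xa i /xa. Qed.

Lemma cube_eq D a b : b \in cube D a -> cube D b = cube D a.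
Proof.
move/cubeP=> ba; apply/setP=> x.
by apply/cubeP/cubeP=> xb i iD; rewrite xb ?ba.
Qed.

Lemma cube_flip D a x i : i \in D -> (flip x i \in cube D a) = (x \in cube D a).
Proof.
move=> iD; apply/cubeP/cubeP=> xa k kD; rewrite -xa // flip_neq //;
  by apply: contraNneq kD => ->.
Qed.

Lemma cube_split D a b i : i \in D -> b \in cube D a -> b i != a i ->
  cube D a = cube (D :\ i) a :|: cube (D :\ i) b.
Proof.
move=> iD ba bi; apply/setP=> x; rewrite in_setU; apply/idP/orP.
  move/cubeP=> xa; have [xi|xi] := eqVneq (x i) (a i); [left|right];
    apply/cubeP=> k; rewrite !inE negb_and negbK => /orP[/eqP->//|kD].
  - exact: xa.
  - by move: xi bi; case: (x i) (a i) (b i) => [] [] [].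
  - by rewrite xa // (cubeP _ _ _ ba).
by case=> /cubeP xa; apply/cubeP=> k kD; rewrite xa ?inE ?(negPf kD) ?andbF //; apply: (cubeP _ _ _ ba).
Qed.

Lemma cube_split_disjoint D a b i : b i != a i ->
  [disjoint cube (D :\ i) a & cube (D :\ i) b].
Proof.
move=> bi; rewrite -setI_eq0; apply/eqP/setP=> x; rewrite !inE.
apply/negP=> /andP[/forallP/(_ i) + /forallP/(_ i)].
by rewrite !inE eqxx /= => /eqP xa /eqP xb; rewrite -xa -xb eqxx in bi.
Qed.

Lemma cube_even D a : D != set0 -> ~~ odd #|cube D a|.
Proof.
case/set0Pn=> i iD; apply: (@fpf_involution_even _ _ (flip^~ i)) => x xC.
rewrite cube_flip // flipK; split=> //.
by apply/eqP=> /ffunP/(_ i); rewrite flip_at; case: (x i).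
Qed.

(* Fink's theorem, for the matchings of the complete graph on a subcube. *)
Lemma fink_subcube D a p : D != set0 -> fpf_involution (cube D a) p ->
  exists r, [/\ fpf_involution (cube D a) r,
                {in cube D a, forall x, Q x (r x)}
              & {in cube D a &, forall x y, connect (union_graph (cube D a) p r) x y}].
Proof.
have Q_fpf (A : {set vertex n}) r : {in A, forall x, [/\ r x \in A, r (r x) = x & Q x (r x)]} ->
    fpf_involution A r.
  move=> rA x xA; have [? ? Qx] := rA x xA; split=> //.
  by apply: contraTneq Qx => ->; rewrite Q_irr.
have [m] := ubnP #|D|; elim: m => // m IHm in D a p * => ltDm D0 pC.
have [paC _ paa] := pC a (cube_refl D a).
(* The cube is split along a direction in which [a] and [p a] differ, so that at least one edge of
   [p] crosses between the halves. *)
have [i pai] : exists i, p a i != a i.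
  apply/existsP; apply: contraNT paa; rewrite negb_exists => /forallP pa.
  by apply/eqP/ffunP=> i; apply/eqP/negPn.
have iD : i \in D by apply: contraNT pai => /(cubeP _ _ _ paC)->.
(* Base case: with the single direction [i] the subcube is one edge, and [r] flips [i]. *)
have [D'0|D'0] := eqVneq (D :\ i) set0.
  exists (flip^~ i); split=> [||x y xC yC].
  - by apply: Q_fpf => x xC; rewrite cube_flip // flipK Q_flip.
  - by move=> x _; apply: Q_flip.
  have [<-|yx] := eqVneq x y; first exact: connect0.
  apply: connect1; rewrite union_graphE xC yC; apply/orP; right; apply/eqP/ffunP=> k.
  have xyD k' : k' != i -> x k' = y k'.
    move=> k'i; have k'D : k' \notin D.
      by apply/negP=> kD; have := in_set0 k'; rewrite -D'0 !inE k'i kD.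
    by rewrite (cubeP _ _ _ xC) // (cubeP _ _ _ yC).
  have [->|ki] := eqVneq k i; last by rewrite flip_neq ?xyD.
  rewrite flip_at; apply/eqP; apply: contraNT yx => yi; apply/eqP/ffunP=> k'.
  have [->|/xyD//] := eqVneq k' i; by move: yi; case: (x i) (y i) => [] [].
have ltD' : #|D :\ i| < m by rewrite -ltnS (leq_trans _ ltDm) // [#|D|](cardsD1 i) iD.
have CE := cube_split iD paC pai.
have disC := cube_split_disjoint D pai.
have aC0 := cube_refl (D :\ i) a; have paC1 := cube_refl (D :\ i) (p a).
have evC0 := cube_even a D'0.
have IH0 q := IHm _ a q ltD' D'0; have IH1 q := IHm _ (p a) q ltD' D'0.
move: CE disC aC0 paC1 evC0 IH0 IH1 pC.
move: (cube D a) (cube (D :\ i) a) (cube (D :\ i) (p a)) => C C0 C1.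
move=> CE disC aC0 paC1 evC0 IH0 IH1 pC.
have C01 x : x \in C0 -> x \in C1 = false.
  by move=> x0; rewrite (disjointFr disC).
have C10 x : x \in C1 -> x \in C0 = false.
  by move=> x1; rewrite (disjointFl disC).
have CP x : x \in C -> (x \in C1) = (x \notin C0).
  by rewrite CE inE; case x0: (x \in C0) => //= _; rewrite C01.
have sC0 x : x \in C0 -> x \in C by rewrite CE inE => ->.
have sC1 x : x \in C1 -> x \in C by rewrite CE inE => ->; rewrite orbT.
(* [U0] and [U1] are the ends of the crossing edges in the two halves; [p] exchanges them. *)
pose U0 := [set x in C0 | p x \notin C0].
pose U1 := [set x in C1 | p x \notin C1].
have aU0 : a \in U0.
  by rewrite inE aC0; apply/negP=> /C01; rewrite paC1.
have pU0 x : x \in U0 -> p x \in U1.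
  rewrite !inE => /andP[x0 px0]; have [pxC ppx _] := pC x (sC0 _ x0).
  by rewrite ppx CP // px0 C01.
have pU1 x : x \in U1 -> p x \in U0.
  rewrite !inE => /andP[x1 px1]; have [pxC ppx _] := pC x (sC1 _ x1).
  by rewrite ppx -CP ?sC1 // x1; move: px1; rewrite CP // negbK => ->.
(* The rest [A :\: U0] is paired up by [p], hence even. *)
have even_U0 (A : {set vertex n}) : A \subset C0 -> ~~ odd #|A| ->
    (forall x, x \in A -> p x \in C0 -> p x \in A) -> ~~ odd #|A :&: U0|.
  move=> sA evA pA; have := evA.
  rewrite -(cardsID U0 A) oddD; suff /negPf-> : ~~ odd #|A :\: U0| by rewrite addbF.
  apply: (@fpf_involution_even _ _ p) => x; rewrite !inE => /andP[xU0 xA].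
  have x0 : x \in C0 by apply: (subsetP sA).
  move: xU0; rewrite x0 /= negbK => px0.
  by have [_ ppx pxx] := pC x (sC0 _ x0); rewrite px0 ppx x0 /= pA.
have [s0 s0P] : exists s, fpf_involution U0 s.
  apply: even_pairing; have -> : U0 = C0 :&: U0.
    by apply/setP=> x; rewrite !inE andbA andbb.
  by apply: even_U0.
pose p0 x := if x \in U0 then s0 x else p x.
have p0P : fpf_involution C0 p0.
  move=> x x0; rewrite /p0; case: ifP => xU.
    by have [sxU -> ->] := s0P x xU; rewrite sxU; split=> //; move: sxU; rewrite inE => /andP[].
  have [_ ppx pxx] := pC x (sC0 _ x0); move: xU; rewrite inE x0 /= => /negbFE px0.
  by rewrite inE px0 ppx x0.
have [r0 [r0P r0Q r0c]] := IH0 _ p0P.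
(* Using [p] in place of [p0] drops the auxiliary edges of [s0]: the cycle formed by [p0] and [r0]
   falls into paths whose ends are the vertices of [U0]. *)
pose g := union_graph C0 p r0.
have g_sym : connect_sym g.
  apply/sym_connect_sym/union_graph_sym => x x0; last by have [] := r0P x x0.
  by have [] := pC x (sC0 _ x0).
(* Every component of [p + r0] in [C0] is closed under both, hence contains an
   even number of vertices that [p] sends to the other half. *)
have [t [tP tg]] : exists t, fpf_involution U0 t /\ forall x, x \in U0 -> connect g x (t x).
  apply: even_class_pairing; [exact: connect0|exact: g_sym|exact: connect_trans|].
  move=> x xU; pose K := [set y in C0 | connect g x y].
  have -> : [set y in U0 | connect g x y] = K :&: U0.
    by apply/setP=> y; rewrite !inE; case: (y \in C0); rewrite ?andbF //= andbC.
  apply: even_U0; first by apply/subsetP=> y; rewrite inE => /andP[].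
    apply: (@fpf_involution_even _ _ r0) => y; rewrite !inE => /andP[y0 xy].
    have [ry0 rry ryy] := r0P y y0; rewrite ry0; split=> //=.
    by apply: connect_trans xy (connect1 _); rewrite /g union_graphE y0 ry0 eqxx orbT.
  move=> y; rewrite !inE => /andP[y0 xy] py0; rewrite py0.
  by apply: connect_trans xy (connect1 _); rewrite /g union_graphE y0 py0 eqxx.
(* A walk in [g] from [p x] to [t (p x)], together with the crossing edges at its two ends, is
   contracted to one edge of [C1]. *)
pose p1 x := if x \in U1 then p (t (p x)) else p x.
have p1P : fpf_involution C1 p1.
  move=> x x1; have [_ ppx pxx] := pC x (sC1 _ x1); rewrite /p1; case: ifP => xU.
    have pxU := pU1 x xU; have [tU tt tx] := tP _ pxU.
    have tC : t (p x) \in C by apply: sC0; move: tU; rewrite inE => /andP[].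
    have [_ ppt _] := pC _ tC.
    have ptU := pU0 _ tU; rewrite ptU ppt tt ppx; split=> //.
      by move: ptU; rewrite inE => /andP[].
    by apply: contraNneq tx => ptx; rewrite -{2}ptx ppt.
  by move: xU; rewrite inE x1 /= => /negbFE px1; rewrite inE px1 ppx x1.
have [r1 [r1P r1Q r1c]] := IH1 _ p1P.
pose r x := if x \in C0 then r0 x else r1 x.
have rP : {in C, forall x, [/\ r x \in C, r (r x) = x & Q x (r x)]}.
  move=> x; rewrite CE inE /r => /orP[x0|x1].
    have [rx0 rrx _] := r0P x x0; rewrite x0 rx0 rrx -CE sC0 //; split=> //; exact: r0Q.
  have [rx1 rrx _] := r1P x x1.
  by rewrite (C10 x) // (C10 (r1 x)) // rrx -CE sC1 //; split=> //; exact: r1Q.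
pose G := union_graph C p r.
have G_sym : connect_sym G.
  apply/sym_connect_sym/union_graph_sym => x xC; last by have [] := rP x xC.
  by have [] := pC x xC.
have Gp x : x \in C -> connect G x (p x).
  by move=> xC; have [pxC _ _] := pC x xC; apply: connect1; rewrite /G union_graphE xC pxC eqxx.
have gG x y : connect g x y -> connect G x y.
  apply: connect_sub => u v /and3P[u0 v0 uv]; apply: connect1.
  by rewrite /G union_graphE !sC0 // /r u0.
(* In a walk of [p1] and [r1], each contracted edge is expanded again: cross to [C0], follow [g],
   and cross back. *)
have C1c : {in C1 &, forall x y, connect G x y}.
  move=> x y x1 y1; have := r1c x y x1 y1.
  apply: (@connect_ind_in _ C1 (fun x => connect G x y)) => // u u1 v.
  case/and3P=> _ v1 uv; split=> //; apply: connect_trans.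
  case/orP: uv => /eqP->; last first.
    have [ru1 _ _] := r1P u u1.
    by apply: connect1; rewrite /G union_graphE !sC1 // /r C10 // eqxx orbT.
  rewrite /p1; case: ifP => uU; last exact/Gp/sC1.
  have pU := pU1 _ uU; have [tU _ _] := tP _ pU.
  apply: connect_trans (Gp _ (sC1 _ u1)) _.
  apply: connect_trans (gG _ _ (tg _ pU)) (Gp _ _).
  by apply: sC0; move: tU; rewrite inE => /andP[].
(* A vertex of [C0] is joined to [a] by a walk of [p0] and [r0]. Until this walk first meets [U0] it
   uses only edges of [g], since [p0] is [p] off [U0]; from there [p] crosses to [C1]. *)
have toC1 x : x \in C -> exists2 y, y \in C1 & connect G x y.
  rewrite CE inE => /orP[x0|x1]; last by exists x; rewrite ?connect0.
  have [y yU xy] : exists2 y, y \in U0 & connect g x y.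
    have := r0c x a x0 aC0.
    apply: (@connect_ind_in _ C0 (fun x => exists2 y, y \in U0 & connect g x y)) => //.
      move=> u u0 v /and3P[_ v0 uv]; split=> // -[y yU vy].
      have [uU|uU] := boolP (u \in U0); first by exists u; rewrite ?connect0.
      exists y => //; apply: connect_trans (connect1 _) vy.
      by move: uv; rewrite /g union_graphE u0 v0 /p0 (negPf uU).
    by exists a; rewrite ?connect0.
  exists (p y); first by have := pU0 _ yU; rewrite inE => /andP[].
  by apply: connect_trans (gG _ _ xy) (Gp _ _); apply: sC0; move: yU; rewrite inE => /andP[].
exists r; split=> [|x xC|x y xC yC]; first exact: Q_fpf.
  by have [] := rP x xC.
have [x1 x1C xx1] := toC1 x xC; have [y1 y1C yy1] := toC1 y yC.
by apply: connect_trans xx1 (connect_trans (C1c _ _ x1C y1C) _); rewrite [connect _ _ _]G_sym.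
Qed.

End Cube.

(** * Edges of concatenated, reversed and mapped walks *)

Section Walks.
Variable T : finType.
Implicit Types (x y z : T) (s : seq T).

Lemma walk_edges_rcons x s y :
  walk_edges x (rcons s y) = rcons (walk_edges x s) [set last x s; y].
Proof. by elim: s x => //= z s IHs x; rewrite -IHs. Qed.

Lemma walk_edges_cat x s y t :
  walk_edges x (s ++ y :: t) = walk_edges x s ++ [set last x s; y] :: walk_edges y t.
Proof. by rewrite /walk_edges pairmap_cat. Qed.

Lemma last_rev_belast x s : last (last x s) (rev (belast x s)) = x.
Proof. by case: s => //= y s; rewrite rev_cons last_rcons. Qed.

Lemma walk_edges_rev x s :
  walk_edges (last x s) (rev (belast x s)) =i walk_edges x s.
Proof.
elim: s x => //= y s IHs x e.
by rewrite rev_cons walk_edges_rcons last_rev_belast mem_rcons !inE IHs setUC.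
Qed.

Lemma rev_walk x s : rev (x :: s) = last x s :: rev (belast x s).
Proof. by rewrite lastI rev_rcons. Qed.

End Walks.

Lemma walk_edges_map (T T' : finType) (f : T -> T') x s :
  walk_edges (f x) (map f s) = [seq f @: e | e : {set T} <- walk_edges x s].
Proof. by elim: s x => //= y s IHs x; rewrite IHs imsetU !imset_set1. Qed.

(** * Cycles alternating between two matchings *)

Section Zigzag.
Variables (T : finType) (e : rel T) (p f : T -> T).

(** If [f] is [p] followed by a second matching [r] and [s] is an orbit of [f], this lists the cycle
    that alternates between edges of [p] and of [r]. *)
Definition zigzag (s : seq T) : seq T := flatten [seq [:: y; p y] | y <- s].

Lemma perm_zigzag s : perm_eq (zigzag s) (s ++ map p s).
Proof.
elim: s => //= x s IHs; rewrite perm_cons /=.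
by rewrite perm_sym (perm_catCA s [:: p x]) /= perm_cons perm_sym.
Qed.

Lemma zigzag_cycle s : (forall x, e x (p x)) -> (forall x, e (p x) (f x)) ->
  fcycle f s -> cycle e (zigzag s).
Proof.
move=> ep ef; case: s => // x0 s.
suff zig x z : path (frel f) x (rcons s z) -> path e x (p x :: rcons (zigzag s) z).
  exact: zig.
elim: s x => [|y s IHs] x /=; first by move/andP=> [/eqP<- _]; rewrite ep ef.
by case/andP=> /eqP<- /IHs /= zs; rewrite ep ef.
Qed.

Lemma zigzag_edges s y : y \in s -> [set y; p y] \in cycle_edges (zigzag s).
Proof.
case: s => // x0 s.
suff zig x z : y \in x :: s -> [set y; p y] \in walk_edges x (p x :: rcons (zigzag s) z).
  exact: zig.
elim: s x => [|x' s IHs] x /=; first by rewrite !inE => /eqP->; rewrite eqxx.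
rewrite in_cons => /orP[/eqP->|/IHs ys]; first exact: mem_head.
by rewrite in_cons; apply/orP; right; rewrite in_cons; apply/orP; right.
Qed.

End Zigzag.

(** * Mates in a matching, and the case of a perfect matching *)

Section Matchings.
Variables (n : nat) (M : {set {set vertex n}}).
Hypothesis matM : matching (@Q n) M.
Implicit Types (x y z : vertex n) (e : {set vertex n}).

Lemma matching_edge_at e x : e \in M -> x \in e -> exists2 y, e = [set x; y] & Q x y.
Proof.
case/andP: matM => /subsetP/(_ e) sME _ /sME/imsetP[[u v] /= uv ->].
by case/set2P=> ->; [exists v|exists u; rewrite 1?setUC 1?Q_sym].
Qed.

Lemma matching_Q x y : [set x; y] \in M -> Q x y.
Proof.
move=> xyM; have [y' eqy xy'] := matching_edge_at xyM (set21 x y).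
have := set22 x y'; rewrite -eqy => /set2P[y'x|<-//].
by rewrite y'x Q_irr in xy'.
Qed.

Lemma matching_unique x y z : [set x; y] \in M -> [set x; z] \in M -> y = z.
Proof.
case/andP: matM => _ /trivIsetP trM xy xz.
have [xyz|/(trM _ _ xy xz)/disjointFr/(_ (set21 x y))] := eqVneq [set x; y] [set x; z].
  have := set22 x y; rewrite xyz => /set2P[yx|//].
  by have := matching_Q xy; rewrite yx Q_irr.
by rewrite set21.
Qed.

Lemma covered_mate x : covered M x -> exists y, [set x; y] \in M.
Proof.
by case/bigcupP=> e eM xe; have [y eE _] := matching_edge_at eM xe; exists y; rewrite -eE.
Qed.

Lemma perfect_matching_cycle : 2 <= n -> (forall x, covered M x) ->
  exists c, hamilton_cycle (@Q n) c /\ cycle_contains M c.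
Proof.
move=> n2 covM.
(* The default [x] is never taken, since every vertex is covered. *)
pose p x := odflt x [pick y | [set x; y] \in M].
have pM x : [set x; p x] \in M.
  rewrite /p; case: pickP => //= nox.
  by have [y xy] := covered_mate (covM x); have := nox y; rewrite xy.
have Qp x : Q x (p x) by apply: matching_Q.
have pp x : p (p x) = x.
  by apply: (@matching_unique (p x)); [|rewrite setUC].
pose x0 : vertex n := [ffun=> false].
have cT x : x \in cube setT x0 by apply/cubeP=> i; rewrite inE.
have [||r [rP rQ conn]] := @fink_subcube n setT x0 p.
- by apply/set0Pn; exists (Ordinal (ltnW n2)).
- by move=> x _; rewrite cT pp; split=> //; apply: contraTneq (Qp x) => ->; rewrite Q_irr.
have rr x : r (r x) = x by have [] := rP x (cT x).
pose f x := r (p x).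
have f_inj : injective f.
  by apply: (@can_inj _ _ _ (fun x => p (r x))) => x; rewrite /f rr pp.
pose o := orbit f x0; pose c := zigzag p o.
(* Both [p] and [r] change parity, so [f] preserves it. Hence [o] and its image under [p] are
   disjoint, which makes [c] free of repetitions. *)
have o_parity x : x \in o -> parity x = parity x0.
  rewrite -fconnect_orbit => /iter_findex <-.
  by elim: (findex _ _ _) => //= k <-; rewrite /f (Q_parity (rQ _ (cT _))) (Q_parity (Qp _)) negbK.
have o_finv x : x \in o -> finv f x \in o.
  by rewrite -!fconnect_orbit => /connect_trans; apply; apply: fconnect_finv.
have of_ x : x \in o -> f x \in o.
  by rewrite -!fconnect_orbit => /connect_trans; apply; apply: fconnect1.
have memc x : (x \in c) = (x \in o) || (p x \in o).
  rewrite (perm_mem (perm_zigzag p o)) mem_cat; congr (_ || _).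
  by rewrite -{1}(pp x) mem_map //; apply: can_inj pp.
have pc x : (p x \in c) = (x \in c) by rewrite !memc pp orbC.
(* For [x] in [o], [r x] is the image under [p] of the predecessor of [x] in the orbit. *)
have rc x : x \in c -> r x \in c.
  rewrite !memc => /orP[xo|/of_]; last by rewrite /f pp => ->.
  by rewrite -(f_finv f_inj x) /f rr pp o_finv ?orbT.
(* [c] is closed under [p] and [r], whose union is connected. *)
have c_all : c =i predT.
  move=> x; apply: (@connect_ind_in _ (cube setT x0) (fun x => x \in c)) (conn x x0 _ _) => //.
    move=> u _ v /and3P[_ _ uv]; split=> //.
    by case/orP: uv => /eqP->; rewrite ?pc // => /rc; rewrite rr.
  by rewrite memc -fconnect_orbit connect0.
have c_uniq : uniq c.
  rewrite (perm_uniq (perm_zigzag p o)) cat_uniq orbit_uniq.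
  rewrite map_inj_uniq ?orbit_uniq ?andbT; last exact: can_inj pp.
  apply/hasPn=> _ /mapP[x xo ->]; apply/negP=> /o_parity.
  by rewrite (Q_parity (Qp x)) o_parity //; case: (parity _).
exists c; split=> [|e eM].
  split=> //; first by apply: zigzag_cycle (cycle_orbit f_inj x0) => // x; apply: rQ.
  rewrite -(card_uniqP c_uniq) (eq_card c_all) card_ffun card_bool card_ord.
  by rewrite (leq_trans _ (leq_pexp2l _ n2)).
have [x xe] : exists x, x \in e.
  case/andP: matM => /subsetP/(_ e eM)/imsetP[[u v] _ ->] _; exists u; exact: set21.
have [y eE _] := matching_edge_at eM xe.
have {}eE : e = [set x; p x].
  by rewrite eE (@matching_unique x y (p x)) -?eE.
have := c_all x; rewrite memc eE inE => /orP[|] xo; last rewrite -{1}(pp x) setUC.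
  exact: zigzag_edges.
by have := zigzag_edges p xo; rewrite pp.
Qed.

End Matchings.

(** * Subcubes as embedded copies of a smaller hypercube *)

Definition ham_path_property d : Prop :=
  forall (M : {set {set vertex d}}) (u v : vertex d),
    matching (@Q d) M -> parity u != parity v -> ~~ covered M u ->
  exists s, hamilton_path (@Q d) u v s /\ path_contains M u s.

Section Embedding.
Variables (n : nat) (D : {set 'I_n}) (a : vertex n).
Implicit Types (x y : vertex #|D|).

(** [enum_val] numbers the directions of [D]; [pick] fails exactly when [i] is outside [D], and the
    coordinate is then that of [a]. *)
Definition emb x : vertex n :=
  [ffun i => if [pick k | enum_val k == i] is Some k then x k else a i].

Lemma emb_in x (k : 'I_#|D|) : emb x (enum_val k) = x k.
Proof.
rewrite ffunE; case: pickP => [k' /eqP/enum_val_inj->//|/(_ k)].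
by rewrite eqxx.
Qed.

Lemma emb_out x i : i \notin D -> emb x i = a i.
Proof.
move=> iD; rewrite ffunE; case: pickP => [k /eqP ki|//].
by rewrite -ki enum_valP in iD.
Qed.

Lemma in_enum_val i : i \in D -> exists k : 'I_#|D|, i = enum_val k.
Proof. by move=> iD; exists (enum_rank_in iD i); rewrite enum_rankK_in. Qed.

Lemma emb_inj : injective emb.
Proof. by move=> x y /ffunP xy; apply/ffunP=> k; rewrite -!emb_in xy. Qed.

Lemma emb_cube x : emb x \in cube D a.
Proof. by apply/cubeP=> i; apply: emb_out. Qed.

Lemma emb_onto (z : vertex n) : z \in cube D a -> exists x, z = emb x.
Proof.
move/cubeP=> za; exists [ffun k => z (enum_val k)]; apply/ffunP=> i.
have [/in_enum_val[k ->]|iD] := boolP (i \in D); first by rewrite emb_in ffunE.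
by rewrite emb_out ?za.
Qed.

Lemma Q_emb x y : Q (emb x) (emb y) = Q x y.
Proof.
have emb_flip k : emb (flip x k) = flip (emb x) (enum_val k).
  apply/ffunP=> i; have [/in_enum_val[k' ->]|iD] := boolP (i \in D).
    by rewrite emb_in ffunE [RHS]ffunE emb_in (inj_eq enum_val_inj).
  rewrite emb_out // flip_neq ?emb_out //.
  by apply: contraNneq iD => ->; apply: enum_valP.
apply/QP/QP=> -[i yE]; last by exists (enum_val i); rewrite -emb_flip yE.
have /in_enum_val[k iE] : i \in D.
  apply: contraT => iD; have := flip_at (emb x) i.
  by rewrite -yE !emb_out //; case: (a i).
by exists k; apply: emb_inj; rewrite emb_flip yE iE.
Qed.

(** The embedding shifts every parity by the same constant, the parity of the number of ones of [a]
    outside [D]. *)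
Lemma parity_emb x y : (parity (emb x) == parity (emb y)) = (parity x == parity y).
Proof.
suff parE w : parity (emb w) = parity w (+) odd #|[set i | (i \notin D) && a i]|.
  by rewrite !parE (inj_eq (@addIb _)).
rewrite /parity -(card_imset _ (@enum_val_inj _ (mem D))) -oddD -cardsUI.
rewrite [X in _ + X](_ : _ = 0) ?addn0; last first.
  apply/eqP; rewrite cards_eq0; apply/eqP/setP=> i; rewrite !inE.
  by apply/negP=> /and3P[/imsetP[k _ ->]]; rewrite enum_valP.
congr (odd #|pred_of_set _|); apply/setP=> i; rewrite !inE.
have [/in_enum_val[k ->]|iD] := boolP (i \in D).
  by rewrite emb_in mem_imset ?inE ?orbF //; apply: enum_val_inj.
rewrite emb_out //; case: imsetP => //= -[k _ iE].
by rewrite iE enum_valP in iD.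
Qed.

End Embedding.

(** * Paths that span a set of vertices and contain the matching edges inside it *)

Section Spanning.
Variable n : nat.
Implicit Types (M : {set {set vertex n}}) (A B e : {set vertex n}) (x y z : vertex n).

Definition spanning_path M A x y s : Prop :=
  [/\ path (@Q n) x s, last x s = y, uniq (x :: s), x :: s =i A
    & {in M, forall e, e \subset A -> e \in walk_edges x s}].

Lemma spanning_path_rev M A x y s : spanning_path M A x y s ->
  spanning_path M A y x (rev (belast x s)).
Proof.
case=> Qs <- us sA sM; split.
- by rewrite rev_path; apply: sub_path Qs => u v; rewrite Q_sym.
- exact: last_rev_belast.
- by rewrite -rev_walk rev_uniq.
- by move=> u; rewrite -rev_walk mem_rev sA.
by move=> e eM eA; rewrite walk_edges_rev sM.
Qed.

(** The last premise says that no edge of [M] runs between [A] and [B], so the two paths together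
    already contain every edge required. *)
Lemma spanning_path_cat M A B x y x' z s t :
    spanning_path M A x y s -> spanning_path M B x' z t ->
    Q y x' -> [disjoint A & B] ->
    {in M, forall e, e \subset A :|: B -> e \subset A \/ e \subset B} ->
  spanning_path M (A :|: B) x z (s ++ x' :: t).
Proof.
case=> Qs sy us sA sM [Qt tz ut tB tM] yx' dAB AB; split.
- by rewrite cat_path Qs sy /= yx' Qt.
- by rewrite last_cat.
- rewrite -cat_cons cat_uniq us ut andbT; apply/hasPn=> u; rewrite tB sA => uB.
  by rewrite (disjointFl dAB).
- by move=> u; rewrite -cat_cons mem_cat sA tB inE.
move=> e eM eAB; rewrite walk_edges_cat mem_cat in_cons.
by case: (AB e eM eAB) => [/(sM e eM)->|/(tM e eM)->] //; rewrite !orbT.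
Qed.

(** The Hamilton path property is transported along [emb], applied to the edges of [M] pulled back
    from the subcube. *)
Lemma subcube_spanning_path (D : {set 'I_n}) M x z :
    ham_path_property #|D| -> matching (@Q n) M -> ~~ covered M x ->
    z \in cube D x -> parity z = ~~ parity x ->
  exists s, spanning_path M (cube D x) x z s.
Proof.
move=> Hd matM covx /emb_onto[v zE] par.
have [u /esym fu] := emb_onto (cube_refl D x).
pose f := @emb n D x; have f_inj : injective f := @emb_inj n D x.
pose M' := [set e : {set vertex #|D|} | f @: e \in M].
have imM (e : {set vertex #|D|}) w : e \in M' -> w \in e -> exists2 w', e = [set w; w'] & Q w w'.
  rewrite inE => eM we; have [z' eE Qz'] := matching_edge_at matM eM (imset_f f we).
  have /imsetP[w' w'e zE'] : z' \in f @: e by rewrite eE set22.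
  exists w'; last by rewrite -(Q_emb x) -/f -zE'.
  by apply: (imset_inj f_inj); rewrite eE zE' imsetU !imset_set1.
have matM' : matching (@Q #|D|) M'.
  apply/andP; split.
    apply/subsetP=> e eM'; have /set0Pn[w we] : e != set0.
      apply: contraTneq eM' => ->; rewrite inE imset0; apply/negP=> M0.
      case/andP: matM => /subsetP/(_ _ M0)/imsetP[[w w'] _ /setP/(_ w)].
      by rewrite set21 inE.
    have [w' -> ww'] := imM e w eM' we.
    by apply/imsetP; exists (w, w').
  apply/trivIsetP=> e1 e2; rewrite !inE => e1M e2M ne.
  case/andP: matM => _ /trivIsetP/(_ _ _ e1M e2M).
  rewrite (inj_eq (imset_inj f_inj)) => /(_ ne) dis.
  rewrite -setI_eq0; apply/eqP/setP=> w; rewrite !inE; apply/negP=> /andP[w1 w2].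
  by have := disjointFr dis (imset_f f w1); rewrite imset_f.
have covu : ~~ covered M' u.
  apply: contra covx => /bigcupP[e]; rewrite inE => eM ue.
  by apply/bigcupP; exists (f @: e) => //; rewrite -fu (imset_f f ue).
have paru : parity u != parity v.
  by rewrite -(parity_emb x) fu -zE par; case: (parity x).
have [s [[Qs sv us sT] sM]] := Hd M' u v matM' paru covu.
exists (map f s); rewrite -{2}fu zE; rewrite -/f; split.
- by rewrite path_map (eq_path (@Q_emb n D x)).
- by rewrite last_map sv.
- by rewrite -map_cons map_inj_uniq.
- move=> w; rewrite -map_cons; apply/mapP/idP => [[w' _ ->]|/emb_onto[w' ->]].
    exact: emb_cube.
  by exists w'; rewrite ?sT.
move=> e eM eC; have eE : e = f @: (f @^-1: e).
  apply/setP=> w; apply/idP/imsetP => [we|[w']]; last by rewrite inE => ? ->.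
  have [w' wE] := emb_onto (subsetP eC w we).
  by exists w'; rewrite // inE /f -wE.
rewrite walk_edges_map eE; apply/map_f/sM.
by rewrite inE -eE.
Qed.

End Spanning.

(** * Traversing the copies of the subcube along a Gray code *)

Section GrayCode.
Variables (n : nat) (M : {set {set vertex n}}) (D : {set 'I_n}).
Hypotheses (matM : matching (@Q n) M) (dirM : directions M \subset D).
Hypotheses (D0 : D != set0) (Hd : ham_path_property #|D|).
Implicit Types (x y z : vertex n) (E : seq 'I_n).

Definition extend_dirs E : {set 'I_n} := foldr (fun j A => j |: A) D E.

(* The reflected Gray code on the directions [j :: E] ends at the initial
   copy of the subcube flipped in direction [j]. *)
Definition gray_end E x : vertex n := if E is j :: _ then flip x j else x.

Definition outside E : bool := uniq E && all [pred j | j \notin D] E.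

Lemma mem_extend_dirs E i : (i \in extend_dirs E) = (i \in D) || (i \in E).
Proof.
elim: E => [|j E IHE] /=; first by rewrite orbF.
by rewrite in_setU1 IHE in_cons orbCA.
Qed.

(** The second half of the reflected code starts where the first half ended, with [j] flipped.
    Running through [E] again flips its head a second time, so only the flip of [j] remains. *)
Lemma gray_end_step E x y j : y \in cube D (gray_end E x) ->
  cube D (gray_end E (flip y j)) = cube D (flip x j).
Proof.
move/cubeP=> yx; apply: cube_eq; apply/cubeP=> i /yx.
by case: E {yx} => [|h E] yi; rewrite !ffunE yi // ffunE addbCA addKb.
Qed.

(** All directions of [M] lie in [D], so no matching edge leaves a copy. *)
Lemma matching_cube e x E : e \in M -> x \in e -> e \subset cube (extend_dirs E) x.
Proof.
move=> eM xe; have [y eE _] := matching_edge_at matM eM xe.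
apply/subsetP=> w; rewrite {1}eE => /set2P[]->; first exact: cube_refl.
apply/cubeP=> i; rewrite mem_extend_dirs negb_or => /andP[iD _].
apply: contraNeq iD => yxi; apply: (subsetP dirM); rewrite inE.
by apply/existsP; exists y; apply/existsP; exists x; rewrite setUC -eE eM.
Qed.

Lemma gray_cat E j x y z s t : outside (j :: E) ->
    spanning_path M (cube (extend_dirs E) x) x y s ->
    spanning_path M (cube (extend_dirs E) (flip y j)) (flip y j) z t ->
  spanning_path M (cube (extend_dirs (j :: E)) x) x z (s ++ flip y j :: t).
Proof.
case/andP=> /= /andP[jE _] /andP[jD _] ps pt.
have jN : j \notin extend_dirs E by rewrite mem_extend_dirs negb_or jD.
have yx : y \in cube (extend_dirs E) x.
  by case: ps => _ <- _ <- _; apply: mem_last.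
have yj : flip y j j != x j by rewrite flip_at (cubeP _ _ _ yx) //; case: (x j).
have EK : (j |: extend_dirs E) :\ j = extend_dirs E by rewrite setU1K.
have yC : flip y j \in cube (j |: extend_dirs E) x.
  rewrite cube_flip ?setU11 //; apply/cubeP=> i; rewrite !inE negb_or => /andP[_ iN].
  exact: (cubeP _ _ _ yx).
rewrite (cube_split _ yC yj) ?setU11 // EK; apply: spanning_path_cat ps pt _ _ _.
- exact: Q_flip.
- by rewrite -EK; apply: cube_split_disjoint.
move=> e eM /subsetP eAB.
have [->|/set0Pn[w we]] := eqVneq e set0; first by left; apply: sub0set.
have := matching_cube E eM we.
by case/setUP: (eAB w we) => wC; rewrite (cube_eq wC); [left|right].
Qed.

(* If [x] is matched to [y], close the path from [x] to [y] through the
   other matching edges into a cycle, and cut the other cycle edge at [x]. *)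
Lemma subcube_path_from x : exists y s,
  [/\ spanning_path M (cube D x) x y s, y \in cube D x & parity y = ~~ parity x].
Proof.
have [i iD] := set0Pn _ D0.
have [covx|ncovx] := boolP (covered M x); last first.
  have fD : flip x i \in cube D x by rewrite cube_flip // cube_refl.
  have [s ps] := subcube_spanning_path Hd matM ncovx fD (parity_flip x i).
  by exists (flip x i), s; rewrite parity_flip.
have [y xyM] := covered_mate matM covx; have Qxy := matching_Q matM xyM.
(* Without its edge at [x] the matching leaves [x] uncovered, so the hypothesis yields a path from
   [x] to [y]. *)
pose M2 := M :\ [set x; y].
have matM2 : matching (@Q n) M2.
  case/andP: matM => sM trM; apply/andP; split.
    exact: subset_trans (subD1set _ _) sM.
  exact: trivIsetS (subD1set _ _) trM.
have covM2 e : e \in M2 -> x \notin e.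
  case/setD1P=> exy eM; apply: contra exy => xe.
  have [y' eE _] := matching_edge_at matM eM xe.
  by rewrite eE (matching_unique matM (z := y) (y := y') (x := x)) -?eE.
have ncov2 : ~~ covered M2 x by apply/bigcupP=> -[e /covM2/negP].
have yD : y \in cube D x.
  by apply: (subsetP (matching_cube [::] xyM (set21 x y))); apply: set22.
have [s [Qs sy us sC sM]] := subcube_spanning_path Hd matM2 ncov2 yD (Q_parity Qxy).
case: s => [|p s] /= in Qs sy us sC sM *; first by rewrite sy Q_irr in Qxy.
case/andP: Qs => xp Qs.
(* [p] is the second vertex of that path. The new path steps from [x] to [y] and runs backwards to
   [p]; it loses only the edge from [x] to [p], which is not in [M2]. *)
exists p, (rev (p :: s)); split; last exact: Q_parity.
  split.
  - rewrite rev_walk sy /= Qxy -sy rev_path.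
    by apply: sub_path Qs => u v; rewrite Q_sym.
  - by rewrite rev_cons last_rcons.
  - by rewrite /= mem_rev rev_uniq.
  - by move=> u; rewrite -sC !in_cons mem_rev in_cons.
  move=> e eM eC; rewrite rev_walk sy /= in_cons -{2}sy walk_edges_rev.
  have [//|exy /=] := eqVneq e [set x; y].
  have eM2 : e \in M2 by rewrite !inE exy.
  have := sM e eM2 eC; rewrite in_cons => /orP[/eqP eE|//].
  by have := covM2 e eM2; rewrite eE set21.
by rewrite -sC !in_cons eqxx orbT.
Qed.

(** Each half reverses parity and so does the step in direction [j] between them, three changes in
    all. *)
Lemma gray_path_from E x : outside E -> exists y s,
  [/\ spanning_path M (cube (extend_dirs E) x) x y s,
      y \in cube D (gray_end E x) & parity y = ~~ parity x].
Proof.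
elim: E x => [|j E IHE] x outE; first exact: subcube_path_from.
have outE' : outside E by case/andP: outE => /= /andP[_ uE] /andP[_ aE]; apply/andP.
have [y1 [s [ps y1E par1]]] := IHE x outE'.
have [y2 [t [pt y2E par2]]] := IHE (flip y1 j) outE'.
exists y2, (s ++ flip y1 j :: t); split; first exact: gray_cat.
  by rewrite -(gray_end_step j y1E).
by rewrite par2 parity_flip par1 negbK.
Qed.

(** Only the last copy has a prescribed exit: there the path is built from the uncovered vertex [z]
    and reversed. All earlier copies are left at a vertex that [gray_path_from] chooses. *)
Lemma gray_path_to E x z : outside E -> ~~ covered M z ->
    z \in cube D (gray_end E x) -> parity z = ~~ parity x ->
  exists s, spanning_path M (cube (extend_dirs E) x) x z s.
Proof.
elim: E x => [|j E IHE] x outE covz zE par.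
  have xD : x \in cube D z by rewrite cube_sym.
  have [|s ps] := subcube_spanning_path Hd matM covz xD; first by rewrite par negbK.
  by exists (rev (belast z s)); rewrite -(cube_eq zE); apply: spanning_path_rev.
have outE' : outside E by case/andP: outE => /= /andP[_ uE] /andP[_ aE]; apply/andP.
have [y [s [ps yE pary]]] := gray_path_from x outE'.
have [|||t pt] := IHE (flip y j) outE'; rewrite ?(gray_end_step j yE) //.
  by rewrite parity_flip pary negbK.
by exists (s ++ flip y j :: t); apply: gray_cat.
Qed.

Lemma nonperfect_matching_cycle z : 2 <= n -> ~~ covered M z ->
  exists c, hamilton_cycle (@Q n) c /\ cycle_contains M c.
Proof.
move=> n2 covz; pose E := enum (~: D).
have outE : outside E.
  by rewrite /outside enum_uniq; apply/allP=> j; rewrite mem_enum in_setC.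
have dirsT : extend_dirs E = setT.
  by apply/setP=> i; rewrite mem_extend_dirs mem_enum !inE orbN.
(* The start [x] is [z] flipped in the head of [E], which makes the code end in the copy of [z]. If
   [E] is empty there is one copy, and any direction of [D] serves. *)
have [x zx zE] : exists2 x, Q z x & z \in cube D (gray_end E x).
  case: (E) => [|j E'] /=; last by exists (flip z j); rewrite ?Q_flip // flipK cube_refl.
  have [i iD] := set0Pn _ D0; exists (flip z i); first exact: Q_flip.
  by rewrite cube_sym cube_flip // cube_refl.
have [|s [Qs sz us sC sM]] := gray_path_to outE covz zE.
  by rewrite (Q_parity zx) negbK.
have CT : cube (extend_dirs E) x = setT.
  by apply/setP=> w; rewrite dirsT in_setT; apply/cubeP=> i; rewrite inE.
rewrite CT in sC sM; exists (x :: s); split=> [|e eM].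
  split=> //; first by rewrite /= rcons_path Qs sz.
    rewrite -(card_uniqP us) (eq_card sC) cardsT.
    by rewrite card_ffun card_bool card_ord (leq_trans _ (leq_pexp2l _ n2)).
  by move=> w; rewrite sC inE.
by rewrite /= walk_edges_rcons mem_rcons in_cons sM ?orbT ?subsetT.
Qed.

End GrayCode.

(** * Enlarging the direction set to exactly [d] directions, and the conclusion *)

Lemma superset_of_card (T : finType) (A : {set T}) d :
  #|A| <= d -> d <= #|T| -> exists2 B : {set T}, A \subset B & #|B| = d.
Proof.
move=> + dT; have [m] := ubnP (d - #|A|); elim: m => // m IHm in A * => ltm.
rewrite leq_eqVlt => /orP[/eqP Ad|Ad]; first by exists A.
have /set0Pn[x] : ~: A != set0.
  by rewrite -cards_eq0 cardsCs setCK subn_eq0 -ltnNge (leq_trans Ad).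
rewrite inE => xA; have cA : #|x |: A| = #|A|.+1 by rewrite cardsU1 xA.
have [||B sAB cB] := IHm (x |: A); rewrite ?cA //.
  by rewrite -ltnS (leq_trans _ ltm) // ltnS subnS prednK // subn_gt0.
by exists B => //; apply: subset_trans sAB; apply: subsetUr.
Qed.

Theorem theorem5 (n d : nat) (M : {set {set vertex n}}) :
  2 <= d -> d <= n ->
  matching (@Q n) M ->
  #|directions M| <= d ->
  (forall (M' : {set {set vertex d}}) (u v : vertex d),
     matching (@Q d) M' ->
     parity u != parity v ->
     ~~ covered M' u ->
     exists s : seq (vertex d),
       hamilton_path (@Q d) u v s /\ path_contains M' u s) ->
  exists c : seq (vertex n),
    hamilton_cycle (@Q n) c /\ cycle_contains M c.
Proof.
move=> d2 dn matM dirM Hd; have n2 := leq_trans d2 dn.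
have [/forallP covM|] := boolP [forall x, covered M x].
  exact: perfect_matching_cycle.
rewrite negb_forall => /existsP[z covz].
have [|D sD cD] := superset_of_card dirM; first by rewrite card_ord.
subst d; apply: (@nonperfect_matching_cycle n M D matM sD _ Hd z n2 covz).
by rewrite -card_gt0 ltnW.
Qed.
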